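(* Let $\mathbf{r}^{(1)},\mathbf{r}^{(2)},\mathbf{r}^{(4)}$ be $C^1_{\#}$ Bezier patches of bi-degree $(3,3)$ with $$\mathbf{r}^{(1)}(1,v)=\mathbf{r}^{(2)}(0,v),\quad \mathbf{r}^{(1)}(u,1)=\mathbf{r}^{(4)}(u,0),\quad \mathbf{r}^{(2)}_u(0,v)=\lambda_{1,2}\,\mathbf{r}^{(1)}_u(1,v),\quad \mathbf{r}^{(4)}_v(u,0)=\lambda_{1,4}\,\mathbf{r}^{(1)}_v(u,1)$$ for all $u,v\in[0,1]$, where $\lambda_{1,2},\lambda_{1,4}$ are constants. Let $\alpha_{i,3},\beta^{(1)}_{i,3},\beta^{(2)}_{i,3},\lambda_{i,3}(1),\kappa_{i,3}(1)$, $i=2,4$, be real constants and put $$\begin{aligned} \lambda_{2,3}(u)&=\lambda_{1,4}(1-u)^2+2\alpha_{2,3}(1-u)u+\lambda_{2,3}(1)u^2,\\ \lambda_{4,3}(v)&=\lambda_{1,2}(1-v)^2+2\alpha_{4,3}(1-v)v+\lambda_{4,3}(1)v^2,\\ \kappa_{2,3}(u)&=3\beta^{(1)}_{2,3}(1-u)^2u+3\beta^{(2)}_{2,3}(1-u)u^2+\kappa_{2,3}(1)u^3,\\ \kappa_{4,3}(v)&=3\beta^{(1)}_{4,3}(1-v)^2v+3\beta^{(2)}_{4,3}(1-v)v^2+\kappa_{4,3}(1)v^3. \end{aligned}$$ Consider the following requirements on a Bezier patch $\mathbf{r}^{(3)}(u,v)=\sum_{i=0}^5\sum_{j=0}^5\mathbf{q}^{(3)}_{i,j}B_i^{(5)}(u)B_j^{(5)}(v)$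 of bi-degree $(5,5)$: for all $u,v\in[0,1]$, $$\begin{aligned} &\mathbf{r}^{(3)}(u,0)=\mathbf{r}^{(2)}(u,1),\qquad \mathbf{r}^{(3)}(0,v)=\mathbf{r}^{(4)}(1,v),\\ &\mathbf{r}^{(3)}_v(u,0)=\lambda_{2,3}(u)\,\mathbf{r}^{(2)}_v(u,1)+\kappa_{2,3}(u)\,\mathbf{r}^{(2)}_u(u,1),\\ &\mathbf{r}^{(3)}_u(0,v)=\lambda_{4,3}(v)\,\mathbf{r}^{(4)}_u(1,v)+\kappa_{4,3}(v)\,\mathbf{r}^{(4)}_v(1,v). \end{aligned}$$ These requirements consistently and uniquely determine the control points $\mathbf{q}^{(3)}_{i,j}$ with $0\le i\le5$, $j\in\{0,1\}$ and with $i\in\{0,1\}$, $0\le j\le5$ (that is, a patch $\mathbf{r}^{(3)}$ of bi-degree $(5,5)$ satisfying all of them exists, and these control points are the same for every such patch) if and only if $$3\lambda_{1,2}\beta^{(1)}_{2,3}=2\alpha_{4,3}-2\lambda_{1,2}\qquad\text{and}\qquad 3\lambda_{1,4}\beta^{(1)}_{4,3}=2\alpha_{2,3}-2\lambda_{1,4}.$$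
   Context: A Bezier patch of bi-degree $(m,n)$ is a map $\mathbf{r}(u,v)=\sum_{i=0}^{m}\sum_{j=0}^{n}\mathbf{q}_{ij}B_i^{(m)}(u)B_j^{(n)}(v)$, $u,v\in[0,1]$, with control points $\mathbf{q}_{ij}\in\mathbb{R}^3$ and Bernstein polynomials $B_i^{(n)}(u)=\binom{n}{i}(1-u)^{n-i}u^i$. A patch is of class $C^1_{\#}$ if it is continuously differentiable on $[0,1]^2$ with $\mathbf{r}_u\times\mathbf{r}_v\ne0$ everywhere. Subscripts $u,v$ denote partial derivatives. The symbols $\lambda_{i,3}(1),\kappa_{i,3}(1)$ denote given constants, which are the values at $1$ of the polynomials defined in the claim. *)

(* Defs.v *)
From mathcomp Require Import all_boot all_order all_algebra.
From mathcomp Require Import all_classical all_reals all_analysis.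
Set Implicit Arguments.
Unset Strict Implicit.
Unset Printing Implicit Defensive.
Import Order.TTheory GRing.Theory Num.Theory.
Import numFieldNormedType.Exports.
Local Open Scope classical_set_scope.
Local Open Scope ring_scope.

Definition bernstein (R : realType) (n i : nat) (u : R) : R :=
  'C(n, i)%:R * (1 - u) ^+ (n - i) * u ^+ i.

(* The defining formula is used for all real u and v, so that the two-sided
   derivatives below make sense on the boundary of the unit square, where they
   coincide with the one-sided derivatives of the patch restricted to it. *)
Definition bezier (R : realType) (m n : nat)
    (q : 'I_m.+1 -> 'I_n.+1 -> 'rV[R]_3) (u v : R) : 'rV[R]_3 :=
  \sum_(i < m.+1) \sum_(j < n.+1) (bernstein m i u * bernstein n j v) *: q i j.

Definition partial_u (R : realType) (r : R -> R -> 'rV[R]_3) (u v : R) :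
    'rV[R]_3 :=
  derive1 (fun x : R => r x v) u.

Definition partial_v (R : realType) (r : R -> R -> 'rV[R]_3) (u v : R) :
    'rV[R]_3 :=
  derive1 (fun y : R => r u y) v.

(* Indices are added modulo 3. *)
Definition crossprod (R : realType) (a b : 'rV[R]_3) : 'rV[R]_3 :=
  \row_(k < 3) (a 0 (k + 1) * b 0 (k + 2) - a 0 (k + 2) * b 0 (k + 1)).

Definition unit_square (R : realType) : set (R * R) :=
  `[0, 1]%classic `*` `[0, 1]%classic.

Definition C1_on_square (R : realType) (r : R -> R -> 'rV[R]_3) : Prop :=
  [/\ forall u v : R, u \in `[0, 1] -> v \in `[0, 1] ->
        derivable (fun x : R => r x v) u 1 /\
        derivable (fun y : R => r u y) v 1,
      {within @unit_square R, continuous (fun p : R * R => partial_u r p.1 p.2)} &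
      {within @unit_square R, continuous (fun p : R * R => partial_v r p.1 p.2)}].

Definition C1_sharp (R : realType) (r : R -> R -> 'rV[R]_3) : Prop :=
  C1_on_square r /\
  forall u v : R, u \in `[0, 1] -> v \in `[0, 1] ->
    crossprod (partial_u r u v) (partial_v r u v) != 0.

(* Main.v *)
Require Import Defs.
From mathcomp Require Import all_boot all_order all_algebra.
From mathcomp Require Import all_classical all_reals all_analysis.
From mathcomp Require Import ring.
Set Implicit Arguments.
Unset Strict Implicit.
Unset Printing Implicit Defensive.
Import Order.TTheory GRing.Theory Num.Theory.
Import numFieldNormedType.Exports.
Local Open Scope classical_set_scope.
Local Open Scope ring_scope.

(** Coordinatewise, the requirements prescribe four univariate polynomials of
degree at most 5: the boundary curves A(u) = r3(u,0) and B(v) = r3(0,v), and the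
cross-boundary derivatives C(u) = r3_v(u,0) and D(v) = r3_u(0,v).  In terms of
control points, A and C are equivalent to the two rows j = 0, 1, and B and D to
the two rows i = 0, 1, because a polynomial of degree at most n is the same thing
as its n+1 Bernstein coefficients ([bcurve_inj], [bcurve_surj]).  So a solution
is always unique on these two strips ([boundary_strip_inj]).  The strips share
only the four points with i, j <= 1, which encode the jet r, r_u, r_v, r_uv at
the corner (0,0).  Hence a solution exists exactly when the two strips agree on
this jet ([corner_interpolation] gives one direction and the equality of mixed
derivatives, [twist_swap], the other):
   A(0) = B(0),  C(0) = B'(0),  A'(0) = D(0),  C'(0) = D'(0).

The first three equations follow from the gluing of the given patches around the
corner r1(1,1).  For the last one, the jets of r2 and r4 at the corner are
expressed by that of r1 ([corner_jet]); the twist r_uv of r1 enters C'(0) and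
D'(0) with the same factor lambda12 * lambda14 and cancels, which leaves
([corner_compatibility])
   C'(0) - D'(0) = (3 lambda12 beta1_23 - (2 alpha43 - 2 lambda12)) r1_u
                 - (3 lambda14 beta1_43 - (2 alpha23 - 2 lambda14)) r1_v.
Since r1 is regular, r1_u and r1_v are linearly independent
([crossprod_neq0_free]), so C'(0) = D'(0) means that both factors vanish. *)

(** * Polynomials in Bernstein form *)

Definition bern (R : realType) (n i : nat) : {poly R} :=
  'C(n, i)%:R *: ((1 - 'X) ^+ (n - i) * 'X^i).

Definition bcurve (R : realType) (n : nat) (c : 'I_n.+1 -> R) : {poly R} :=
  \sum_(i < n.+1) c i *: bern R n i.

Lemma poly_eq_unit_interval (R : realType) (p r : {poly R}) :
  (forall u : R, u \in `[0, 1] -> p.[u] = r.[u]) -> p = r.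
Proof.
move=> epr; apply/eqP; rewrite -subr_eq0; apply/eqP.
pose rs := [seq (i.+1%:R^-1 : R) | i <- iota 0 (size (p - r))].
apply: (@roots_geq_poly_eq0 _ _ rs); last by rewrite size_map size_iota.
  apply/allP => _ /mapP[i _ ->]; rewrite /root hornerD hornerN epr ?subrr//.
  by rewrite in_itv /= invr_ge0 ler0n/= invf_le1 ?ltr0n// ler1n.
rewrite map_inj_uniq ?iota_uniq// => i j /invr_inj /eqP.
by rewrite eqr_nat eqSS => /eqP.
Qed.

(** The polynomials X^i (1 - X)^(n - i) are the Bernstein polynomials without their
binomial factors, for which both inductions on n are immediate.

Evaluating at 0 isolates the first coefficient; once it is zero, a factor 'X
can be cancelled, which leaves a relation of degree one less. *)
Lemma pascal_basis_free (R : realType) (n : nat) (c : 'I_n.+1 -> R) :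
  \sum_(i < n.+1) c i *: ((1 - 'X) ^+ (n - i) * 'X^i) = 0 :> {poly R} ->
  forall i, c i = 0.
Proof.
elim: n c => [|n IH] c.
  rewrite big_ord_recl big_ord0 addr0 !expr0 mulr1 => h i.
  by rewrite (ord1 i); move/(congr1 (coefp 0)): h => /=; rewrite coefZ coef1 mulr1 coef0.
rewrite big_ord_recl /= subn0 expr0 mulr1.
under eq_bigr => i _ do rewrite /bump /= add1n subSS exprSr mulrA scalerAl.
rewrite -big_distrl /= => h.
have c0 : c ord0 = 0.
  move/(congr1 (fun p : {poly R} => p.[0])): h.
  by rewrite !hornerE/= subr0 expr1n mulr1.
move: h; rewrite c0 scale0r add0r => /eqP.
rewrite mulf_eq0 polyX_eq0 orbF => /eqP /(IH (fun i => c (lift ord0 i))) h i.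
by case: (unliftP ord0 i) => [j ->|-> //]; exact: h.
Qed.

Lemma size_one_subX_exp (R : realType) (n : nat) :
  (size ((1 - 'X : {poly R}) ^+ n) <= n.+1)%N.
Proof.
rewrite (leq_trans (size_poly_exp_leq _ _))// -opprB size_polyN size_XsubC.
by rewrite mul1n.
Qed.

(** Subtracting p(0) (1 - 'X)^n produces a root at 0, and the quotient by 'X has
degree one less. *)
Lemma pascal_basis_spans (R : realType) (n : nat) (p : {poly R}) :
  (size p <= n.+1)%N ->
  exists c : 'I_n.+1 -> R,
    p = \sum_(i < n.+1) c i *: ((1 - 'X) ^+ (n - i) * 'X^i).
Proof.
elim: n p => [|n IH] p sp.
  exists (fun _ => p`_0); rewrite big_ord_recl big_ord0 addr0 !expr0 mulr1.
  by rewrite {1}(size1_polyC sp) alg_polyC.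
set r := p - p.[0] *: (1 - 'X) ^+ n.+1.
have /factor_theorem[s es] : root r 0.
  by rewrite /root /r !hornerE /= subr0 expr1n mulr1 subrr.
have sr : (size r <= n.+2)%N.
  rewrite (leq_trans (size_polyD _ _))// geq_max sp size_polyN.
  by rewrite (leq_trans (size_scale_leq _ _))// size_one_subX_exp.
have /IH[c ec] : (size s <= n.+1)%N.
  have [->|s0] := eqVneq s 0; first by rewrite size_poly0.
  by move: sr; rewrite es polyC0 subr0 size_mulX.
exists (fun i => oapp c p.[0] (unlift ord0 i)).
rewrite big_ord_recl unlift_none /= subn0 expr0 mulr1.
under eq_bigr => i _ do
  rewrite liftK /= /bump /= add1n subSS exprSr mulrA scalerAl.
rewrite -big_distrl /= -ec.
have -> : (s * 'X = r) by rewrite es polyC0 subr0.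
by rewrite /r addrC subrK.
Qed.

Lemma size_bcurve (R : realType) (n : nat) (c : 'I_n.+1 -> R) :
  (size (bcurve c) <= n.+1)%N.
Proof.
apply: (leq_trans (size_sum _ _ _)); apply/bigmax_leqP => i _.
rewrite (leq_trans (size_scale_leq _ _))// (leq_trans (size_scale_leq _ _))//.
have [->|h0] := eqVneq ((1 - 'X : {poly R}) ^+ (n - i)) 0.
  by rewrite mul0r size_poly0.
rewrite size_mulXn// (leq_trans (leq_add (leqnn _) (size_one_subX_exp _ _)))//.
by rewrite addnS subnKC// -ltnS.
Qed.

Lemma bin_ord_neq0 (R : realType) (n : nat) (i : 'I_n.+1) :
  'C(n, i)%:R != 0 :> R.
Proof. by rewrite pnatr_eq0 -lt0n bin_gt0 -ltnS. Qed.

Lemma bcurve_inj (R : realType) (n : nat) (c d : 'I_n.+1 -> R) :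
  bcurve c = bcurve d -> c =1 d.
Proof.
move=> /eqP; rewrite -subr_eq0 -sumrB => /eqP.
under eq_bigr => i _ do rewrite -scalerBl /bern scalerA.
move/(pascal_basis_free (c := fun i => (c i - d i) * 'C(n, i)%:R)) => h i.
apply: (mulIf (bin_ord_neq0 R i)); apply/eqP.
by rewrite -subr_eq0 -mulrBl h.
Qed.

Lemma bcurve_surj (R : realType) (n : nat) (p : {poly R}) :
  (size p <= n.+1)%N -> exists c : 'I_n.+1 -> R, p = bcurve c.
Proof.
move=> /pascal_basis_spans[c ->]; exists (fun i => c i / 'C(n, i)%:R).
by apply: eq_bigr => i _; rewrite /bern scalerA divfK// bin_ord_neq0.
Qed.

Lemma bcurve0 (R : realType) (n : nat) (c : 'I_n.+1 -> R) :
  (bcurve c).[0] = c ord0.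
Proof.
rewrite /bcurve big_ord_recl hornerD horner_sum big1 => [|i _]; last first.
  by rewrite /bern !hornerE /= expr0n /= !mulr0.
rewrite addr0 /bern bin0 scale1r !hornerE /=.
by rewrite subr0 expr1n !mulr1.
Qed.

(** Only the first two Bernstein polynomials have a nonzero derivative at 0. *)
Lemma deriv_bcurve0 (R : realType) (n : nat) (c : 'I_n.+2 -> R) :
  (bcurve c)^`().[0] = n.+1%:R * (c (lift ord0 ord0) - c ord0).
Proof.
rewrite /bcurve !big_ord_recl !derivD !hornerD raddf_sum horner_sum big1.
  rewrite addr0 /bern /= /bump /= bin0 bin1 subn0 subSS subn0.
  rewrite !(derivZ, derivM, deriv_exp, derivB, derivX, derivXn) derivC.
  rewrite !(hornerE, hornerMn) /= !subr0 !expr1n.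
  ring.
move=> i _; rewrite /bern /= /bump /= !add1n !derivZ !exprSr !mulrA derivM.
by rewrite derivX !hornerE /= mulr0 mul0r.
Qed.

Lemma horner_bcurve (R : realType) (n : nat) (c : 'I_n.+1 -> R) (u : R) :
  (bcurve c).[u] = \sum_(i < n.+1) c i * (bern R n i).[u].
Proof. by rewrite horner_sum; apply: eq_bigr => i _; rewrite hornerZ. Qed.

Lemma horner_deriv_bcurve (R : realType) (n : nat) (c : 'I_n.+1 -> R) (u : R) :
  (bcurve c)^`().[u] = \sum_(i < n.+1) c i * (bern R n i)^`().[u].
Proof.
rewrite raddf_sum horner_sum.
by apply: eq_bigr => i _; rewrite /= derivZ hornerZ.
Qed.

(** * Isoparametric curves of a scalar control net *)

(** The isoparametric curve u |-> s(u,v) of the tensor-product polynomial s with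
control net c.  Together with [transpose] it also gives the curves of constant
u, so that every fact has to be proved for one parameter direction only. *)
Definition isocurve (R : realType) (m n : nat) (c : 'I_m.+1 -> 'I_n.+1 -> R)
    (v : R) : {poly R} :=
  bcurve (fun i => (bcurve (c i)).[v]).

(** The cross-boundary derivative u |-> s_v(u,v) along the curve of parameter v. *)
Definition crosscurve (R : realType) (m n : nat) (c : 'I_m.+1 -> 'I_n.+1 -> R)
    (v : R) : {poly R} :=
  bcurve (fun i => (bcurve (c i))^`().[v]).

Definition transpose (R : Type) (m n : nat) (c : 'I_m.+1 -> 'I_n.+1 -> R) :=
  fun j i => c i j.

Lemma tensor_swap (R : realType) (m n : nat) (c : 'I_m.+1 -> 'I_n.+1 -> R)
    (f : 'I_m.+1 -> R) (g : 'I_n.+1 -> R) :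
  \sum_i (\sum_j c i j * g j) * f i =
  \sum_j (\sum_i transpose c j i * f i) * g j.
Proof.
under eq_bigr => i _ do rewrite big_distrl.
under [RHS]eq_bigr => j _ do rewrite big_distrl.
rewrite exchange_big; apply: eq_bigr => j _; apply: eq_bigr => i _ /=.
by rewrite mulrAC.
Qed.

(** The three swap lemmas read a value of s, s_v and s_uv off either family of
isoparametric curves. *)
Lemma isocurve_swap (R : realType) (m n : nat) (c : 'I_m.+1 -> 'I_n.+1 -> R)
    (u v : R) :
  (isocurve c v).[u] = (isocurve (transpose c) u).[v].
Proof.
rewrite !horner_bcurve.
under eq_bigr => i _ do rewrite horner_bcurve.
under [RHS]eq_bigr => j _ do rewrite horner_bcurve.
exact: tensor_swap.
Qed.

Lemma crosscurve_swap (R : realType) (m n : nat) (c : 'I_m.+1 -> 'I_n.+1 -> R)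
    (u v : R) :
  (crosscurve c v).[u] = (isocurve (transpose c) u)^`().[v].
Proof.
rewrite horner_bcurve horner_deriv_bcurve.
under eq_bigr => i _ do rewrite horner_deriv_bcurve.
under [RHS]eq_bigr => j _ do rewrite horner_bcurve.
exact: tensor_swap.
Qed.

Lemma twist_swap (R : realType) (m n : nat) (c : 'I_m.+1 -> 'I_n.+1 -> R)
    (u v : R) :
  (crosscurve c v)^`().[u] = (crosscurve (transpose c) u)^`().[v].
Proof.
rewrite !horner_deriv_bcurve.
under eq_bigr => i _ do rewrite horner_deriv_bcurve.
under [RHS]eq_bigr => j _ do rewrite horner_deriv_bcurve.
exact: tensor_swap.
Qed.

Lemma isocurve0 (R : realType) (m n : nat) (c : 'I_m.+1 -> 'I_n.+1 -> R) :
  isocurve c 0 = bcurve (fun i => c i ord0).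
Proof. by apply: eq_bigr => i _; rewrite bcurve0. Qed.

Lemma crosscurve0 (R : realType) (m n : nat) (c : 'I_m.+1 -> 'I_n.+2 -> R) :
  crosscurve c 0 =
  bcurve (fun i => n.+1%:R * (c i (lift ord0 ord0) - c i ord0)).
Proof. by apply: eq_bigr => i _; rewrite deriv_bcurve0. Qed.

(** * Interpolation of boundary data at a corner *)

(** The boundary curve has the row j = 0 as Bernstein coefficients, and the
cross-boundary derivative a multiple of the differences between the rows j = 1
and j = 0. *)
Lemma boundary_strip_inj (R : realType) (m n : nat)
    (c d : 'I_m.+1 -> 'I_n.+2 -> R) :
  isocurve c 0 = isocurve d 0 -> crosscurve c 0 = crosscurve d 0 ->
  forall i (j : 'I_n.+2), (j <= 1)%N -> c i j = d i j.
Proof.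
rewrite !isocurve0 !crosscurve0 => /bcurve_inj e0 /bcurve_inj e1 i j j1.
have /= h0 := e0 i.
have /= := e1 i; rewrite h0 => /(mulfI (_ : n.+1%:R != 0)) h1.
case: (unliftP ord0 j) j1 => [j' ->|-> //].
rewrite /= /bump /= add1n ltnS leqn0 => /eqP j'0.
have -> : j' = ord0 by exact: val_inj.
by apply: (addIr (- d i ord0)); apply: h1; rewrite pnatr_eq0.
Qed.

(** The coefficients of A and C dictate the rows j = 0, 1 of the net, those of B and
D the rows i = 0, 1.  The four corner equations say exactly that both
prescriptions agree on the 2 x 2 block where the rows overlap. *)
Lemma corner_interpolation (R : realType) (m n : nat) (A C B D : {poly R}) :
  (size A <= m.+2)%N -> (size C <= m.+2)%N ->
  (size B <= n.+2)%N -> (size D <= n.+2)%N ->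
  A.[0] = B.[0] -> C.[0] = B^`().[0] -> A^`().[0] = D.[0] ->
  C^`().[0] = D^`().[0] ->
  exists c : 'I_m.+2 -> 'I_n.+2 -> R,
    [/\ isocurve c 0 = A, crosscurve c 0 = C,
        isocurve (transpose c) 0 = B & crosscurve (transpose c) 0 = D].
Proof.
move=> /bcurve_surj[a ->] /bcurve_surj[c ->] /bcurve_surj[b ->].
move=> /bcurve_surj[d ->]; rewrite !deriv_bcurve0 !bcurve0 => ab cb ad cd.
have m0 : m.+1%:R != 0 :> R by rewrite pnatr_eq0.
have n0 : n.+1%:R != 0 :> R by rewrite pnatr_eq0.
pose one k : 'I_k.+2 := lift ord0 ord0.
(* On the overlap the rows j = 0, 1 take precedence; any value would do away from
   the two strips. *)
pose net (i : 'I_m.+2) (j : 'I_n.+2) :=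
  if j == ord0 then a i
  else if j == one n then a i + c i / n.+1%:R
  else if i == ord0 then b j
  else b j + d j / m.+1%:R.
have b1 : b (one n) = a ord0 + c ord0 / n.+1%:R.
  by rewrite ab cb mulrAC divff// mul1r addrC subrK.
have a1 : a (one m) = b ord0 + d ord0 / m.+1%:R.
  by rewrite -ad -ab mulrAC divff// mul1r addrC subrK.
(* By b1 and a1, the rows j = 0, 1 already meet the prescription for i = 0. *)
have net_b j : net ord0 j = b j.
  by rewrite /net; case: eqP => [->//|_]; case: eqP => [->|_].
have net_d j : net (one m) j = b j + d j / m.+1%:R.
  rewrite /net; case: eqP => [->//|_]; case: eqP => [->|_] //=.
  rewrite -/(one m) b1 a1 ab.
  have -> : c (one m) = c ord0 + n.+1%:R * (d (one n) - d ord0) / m.+1%:R.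
    by rewrite -cd mulrAC divff// mul1r addrC subrK.
  by field; rewrite !nat1r m0 n0.
exists net; split.
- rewrite isocurve0; apply: eq_bigr => i _; by rewrite /net eqxx.
- rewrite crosscurve0; apply: eq_bigr => i _; congr (_ *: _).
  by rewrite /net eqxx /= addrAC subrr add0r mulrC divfK.
- by rewrite isocurve0; apply: eq_bigr => i _; rewrite /transpose net_b.
- rewrite crosscurve0; apply: eq_bigr => i _; congr (_ *: _).
  by rewrite /transpose net_b net_d addrAC subrr add0r mulrC divfK.
Qed.

(** * Bezier patches coordinate by coordinate *)

Lemma bernsteinE (R : realType) (n i : nat) (u : R) :
  bernstein n i u = (bern R n i).[u].
Proof. by rewrite /bernstein /bern !hornerE. Qed.

Definition coord (R : realType) (m n : nat)
    (q : 'I_m.+1 -> 'I_n.+1 -> 'rV[R]_3) (k : 'I_3) :=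
  fun i j => q i j 0 k.

Lemma bezierE (R : realType) (m n : nat)
    (q : 'I_m.+1 -> 'I_n.+1 -> 'rV[R]_3) (u v : R) :
  bezier q u v = \row_k (isocurve (coord q k) v).[u].
Proof.
apply/rowP => k; rewrite mxE horner_bcurve summxE; apply: eq_bigr => i _.
rewrite summxE horner_bcurve big_distrl; apply: eq_bigr => j _ /=.
by rewrite mxE !bernsteinE mulrC -mulrA [X in _ * X]mulrC.
Qed.

Lemma bezier_transposeE (R : realType) (m n : nat)
    (q : 'I_m.+1 -> 'I_n.+1 -> 'rV[R]_3) (u v : R) :
  bezier q u v = \row_k (isocurve (transpose (coord q k)) u).[v].
Proof. by rewrite bezierE; apply/rowP => k; rewrite !mxE isocurve_swap. Qed.

Lemma derive1_poly_row (R : realType) (n : nat) (p : 'I_n -> {poly R}) (x : R) :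
  derive1 (fun y => \row_k (p k).[y]) x = \row_k (p k)^`().[x].
Proof.
have entry (i : 'I_1) k :
    (fun y => (\row_k (p k).[y]) i k) = horner (p k).
  by apply/funext => y; rewrite mxE.
rewrite derive1E derive_mx.
  by apply/matrixP => i k; rewrite !mxE entry derive_val.
apply/derivable_mxP => i k; rewrite entry; exact: derivable_horner.
Qed.

Lemma partial_uE (R : realType) (m n : nat)
    (q : 'I_m.+1 -> 'I_n.+1 -> 'rV[R]_3) (u v : R) :
  partial_u (bezier q) u v = \row_k (isocurve (coord q k) v)^`().[u].
Proof.
rewrite -derive1_poly_row /partial_u; congr derive1.
by apply/funext => x; rewrite bezierE.
Qed.

Lemma partial_vE (R : realType) (m n : nat)
    (q : 'I_m.+1 -> 'I_n.+1 -> 'rV[R]_3) (u v : R) :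
  partial_v (bezier q) u v = \row_k (crosscurve (coord q k) v).[u].
Proof.
transitivity (\row_k (isocurve (transpose (coord q k)) u)^`().[v]).
  rewrite -derive1_poly_row /partial_v; congr derive1.
  by apply/funext => x; rewrite bezier_transposeE.
by apply/rowP => k; rewrite !mxE crosscurve_swap.
Qed.

Lemma partial_u_transposeE (R : realType) (m n : nat)
    (q : 'I_m.+1 -> 'I_n.+1 -> 'rV[R]_3) (u v : R) :
  partial_u (bezier q) u v = \row_k (crosscurve (transpose (coord q k)) u).[v].
Proof. by rewrite partial_uE; apply/rowP => k; rewrite !mxE crosscurve_swap. Qed.

Lemma partial_v_transposeE (R : realType) (m n : nat)
    (q : 'I_m.+1 -> 'I_n.+1 -> 'rV[R]_3) (u v : R) :
  partial_v (bezier q) u v =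
  \row_k (isocurve (transpose (coord q k)) u)^`().[v].
Proof. by rewrite partial_vE; apply/rowP => k; rewrite !mxE crosscurve_swap. Qed.

Lemma poly_row_eq (R : realType) (n : nat) (p r : 'I_n -> {poly R}) :
  (forall u : R, u \in `[0, 1] -> \row_k (p k).[u] = \row_k (r k).[u]) <->
  (forall k, p k = r k).
Proof.
split=> [h k|h u _]; last by apply/rowP => k; rewrite !mxE h.
by apply: poly_eq_unit_interval => u /h /rowP /(_ k); rewrite !mxE.
Qed.

(** * Jets at the common corner *)

(** Propagates the jet of a patch c at (1,1) to the neighbour d, glued to c along
u = 1, at (0,1).  Differentiating the two gluing identities along the common
boundary gives s_v and s_uv; the factor lambda is constant, so no further term
appears in the twist. *)
Lemma corner_jet (R : realType) (m n m' : nat) (lambda : R)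
    (c : 'I_m.+1 -> 'I_n.+1 -> R) (d : 'I_m'.+1 -> 'I_n.+1 -> R) :
  isocurve (transpose c) 1 = isocurve (transpose d) 0 ->
  crosscurve (transpose d) 0 = lambda *: crosscurve (transpose c) 1 ->
  [/\ (isocurve d 1).[0] = (isocurve c 1).[1],
      (isocurve d 1)^`().[0] = lambda * (crosscurve (transpose c) 1).[1],
      (crosscurve d 1).[0] = (crosscurve c 1).[1] &
      (crosscurve d 1)^`().[0] = lambda * (crosscurve c 1)^`().[1] ].
Proof.
move=> h0 h1; split.
- by rewrite isocurve_swap -h0 isocurve_swap.
- by rewrite -(crosscurve_swap (transpose d)) h1 hornerZ.
- by rewrite crosscurve_swap -h0 -crosscurve_swap.
- by rewrite twist_swap h1 derivZ hornerZ twist_swap.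
Qed.

(** The functions lambda and kappa are themselves given in Bernstein form: [bquad]
and [bcubic] have the coefficients a0, a1, a2 and 0, b1, b2, b3. *)
Definition bquad (R : realType) (a0 a1 a2 : R) : {poly R} :=
  bcurve (fun i : 'I_3 => nth 0 [:: a0; a1; a2] i).

Definition bcubic (R : realType) (b1 b2 b3 : R) : {poly R} :=
  bcurve (fun i : 'I_4 => nth 0 [:: 0; b1; b2; b3] i).

Lemma horner_bquad (R : realType) (a0 a1 a2 u : R) :
  (bquad a0 a1 a2).[u] =
  a0 * (1 - u) ^+ 2 + 2 * a1 * (1 - u) * u + a2 * u ^+ 2.
Proof.
rewrite horner_bcurve !big_ord_recl big_ord0 /= -!bernsteinE /bernstein /=.
rewrite /bump /= bin0 bin1 binn.
ring.
Qed.

Lemma horner_bcubic (R : realType) (b1 b2 b3 u : R) :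
  (bcubic b1 b2 b3).[u] =
  3 * b1 * (1 - u) ^+ 2 * u + 3 * b2 * (1 - u) * u ^+ 2 + b3 * u ^+ 3.
Proof.
rewrite horner_bcurve !big_ord_recl big_ord0 /= -!bernsteinE /bernstein /=.
rewrite /bump /= bin0 bin1 binn (_ : 'C(3, 1 + 1) = 3)//.
ring.
Qed.

(** The right-hand side lambda s_v + kappa s_u prescribed for the cross-boundary
derivative of the new patch, along the boundary v = 1 of the patch d. *)
Definition glued_tangent (R : realType) (m n : nat)
    (l a l1 b1 b2 k1 : R) (d : 'I_m.+1 -> 'I_n.+1 -> R) : {poly R} :=
  bquad l a l1 * crosscurve d 1 + bcubic b1 b2 k1 * (isocurve d 1)^`().

Lemma size_glued_tangent (R : realType) (m n : nat) (l a l1 b1 b2 k1 : R)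
    (d : 'I_m.+1 -> 'I_n.+1 -> R) :
  (size (glued_tangent l a l1 b1 b2 k1 d) <= m.+3)%N.
Proof.
have sA : (size (isocurve d 1)^`() <= m)%N.
  rewrite (leq_trans (size_poly _ _))// -subn1 leq_subLR add1n.
  exact: size_bcurve.
rewrite (leq_trans (size_polyD _ _))// geq_max; apply/andP; split.
  rewrite (leq_trans (size_polyMleq _ _))// -subn1 leq_subLR.
  exact: leq_trans (leq_add (size_bcurve _) (size_bcurve _)) _.
rewrite (leq_trans (size_polyMleq _ _))// -subn1 leq_subLR.
exact: leq_trans (leq_add (size_bcurve _) sA) _.
Qed.

Lemma glued_tangent_jet (R : realType) (m n : nat) (l a l1 b1 b2 k1 : R)
    (d : 'I_m.+1 -> 'I_n.+1 -> R) (g := glued_tangent l a l1 b1 b2 k1 d) :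
  g.[0] = l * (crosscurve d 1).[0] /\
  g^`().[0] = (2 * a - 2 * l) * (crosscurve d 1).[0] +
    l * (crosscurve d 1)^`().[0] + 3 * b1 * (isocurve d 1)^`().[0].
Proof.
split; rewrite /g /glued_tangent ?derivD ?derivM !hornerD !hornerM.
  by rewrite !bcurve0 /= mul0r addr0.
by rewrite !deriv_bcurve0 !bcurve0 /=; ring.
Qed.

(** [corner_jet] is applied to c1, c2, and to the transposed pair c1, c4.  Then
C'(0) and D'(0) both contain l12 * l14 times the twist of c1 at (1,1), by the
symmetry of mixed derivatives, and the difference involves first derivatives
only. *)
Lemma corner_compatibility (R : realType)
    (c1 c2 c4 : 'I_4 -> 'I_4 -> R) (l12 l14 a2 l2 b2 b2' k2 a4 l4 b4 b4' k4 : R)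
    (A := isocurve c2 1) (B := isocurve (transpose c4) 1)
    (C := glued_tangent l14 a2 l2 b2 b2' k2 c2)
    (D := glued_tangent l12 a4 l4 b4 b4' k4 (transpose c4)) :
  isocurve (transpose c1) 1 = isocurve (transpose c2) 0 ->
  crosscurve (transpose c2) 0 = l12 *: crosscurve (transpose c1) 1 ->
  isocurve c1 1 = isocurve c4 0 ->
  crosscurve c4 0 = l14 *: crosscurve c1 1 ->
  [/\ A.[0] = B.[0], C.[0] = B^`().[0], A^`().[0] = D.[0] &
      C^`().[0] - D^`().[0] =
        (3 * l12 * b2 - (2 * a4 - 2 * l12)) * (isocurve c1 1)^`().[1] -
        (3 * l14 * b4 - (2 * a2 - 2 * l14)) * (crosscurve c1 1).[1] ].
Proof.
move=> g2 dg2 g4 dg4.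
have [A0 A1 N0 N1] := corner_jet g2 dg2.
have [B0 B1 M0 M1] := @corner_jet _ _ _ _ l14 (transpose c1) (transpose c4) g4 dg4.
have [C0 C1] := glued_tangent_jet l14 a2 l2 b2 b2' k2 c2.
have [D0 D1] := glued_tangent_jet l12 a4 l4 b4 b4' k4 (transpose c4).
have ru := crosscurve_swap (transpose c1) 1 1.
split.
- by rewrite A0 B0 isocurve_swap.
- by rewrite C0 N0 B1.
- by rewrite D0 M0 A1.
- rewrite C1 D1 N0 N1 A1 M0 M1 B1 -twist_swap.
  rewrite (_ : isocurve c1 = isocurve (transpose (transpose c1)))// -ru.
  rewrite (_ : crosscurve (transpose (transpose c1)) = crosscurve c1)//.
  ring.
Qed.

(** If a x = b y, then a (x /\ y) = b (y /\ y) = 0, and likewise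
b (x /\ y) = a (x /\ x) = 0, where /\ is the cross product. *)
Lemma crossprod_neq0_free (R : realType) (x y : 'rV[R]_3) (a b : R) :
  crossprod x y != 0 -> a *: x = b *: y -> a = 0 /\ b = 0.
Proof.
move=> xy0 /rowP e.
have exy k : a * x 0 k = b * y 0 k by have := e k; rewrite !mxE.
have [k xyk] : exists k, crossprod x y 0 k != 0.
  apply/existsP; apply: contraNT xy0; rewrite negb_exists => /forallP h.
  by apply/eqP/rowP => k; rewrite [RHS]mxE; apply/eqP; rewrite -[_ == _]negbK h.
have zero z : z * crossprod x y 0 k = 0 -> z = 0.
  by move=> /eqP; rewrite mulf_eq0 (negPf xyk) orbF => /eqP.
split; apply: zero; rewrite mxE mulrBr.
  by rewrite !mulrA !exy; ring.
rewrite !(mulrCA b) -!exy; ring.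
Qed.

(** * Existence and uniqueness of the glued patch *)

Theorem mainTheorem4 (R : realType)
    (q1 q2 q4 : 'I_4 -> 'I_4 -> 'rV[R]_3)
    (lambda12 lambda14 : R)
    (alpha23 beta1_23 beta2_23 lambda23_1 kappa23_1 : R)
    (alpha43 beta1_43 beta2_43 lambda43_1 kappa43_1 : R) :
  let r1 := bezier q1 in
  let r2 := bezier q2 in
  let r4 := bezier q4 in
  let lambda23 := fun u : R =>
    lambda14 * (1 - u) ^+ 2 + 2 * alpha23 * (1 - u) * u
    + lambda23_1 * u ^+ 2 in
  let lambda43 := fun v : R =>
    lambda12 * (1 - v) ^+ 2 + 2 * alpha43 * (1 - v) * v
    + lambda43_1 * v ^+ 2 in
  let kappa23 := fun u : R =>
    3 * beta1_23 * (1 - u) ^+ 2 * u + 3 * beta2_23 * (1 - u) * u ^+ 2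
    + kappa23_1 * u ^+ 3 in
  let kappa43 := fun v : R =>
    3 * beta1_43 * (1 - v) ^+ 2 * v + 3 * beta2_43 * (1 - v) * v ^+ 2
    + kappa43_1 * v ^+ 3 in
  let requirements := fun q3 : 'I_6 -> 'I_6 -> 'rV[R]_3 =>
    let r3 := bezier q3 in
    [/\ forall u : R, u \in `[0, 1] -> r3 u 0 = r2 u 1,
        forall v : R, v \in `[0, 1] -> r3 0 v = r4 1 v,
        forall u : R, u \in `[0, 1] ->
          partial_v r3 u 0 =
          lambda23 u *: partial_v r2 u 1 + kappa23 u *: partial_u r2 u 1 &
        forall v : R, v \in `[0, 1] ->
          partial_u r3 0 v =
          lambda43 v *: partial_u r4 1 v + kappa43 v *: partial_v r4 1 v] in
  C1_sharp r1 -> C1_sharp r2 -> C1_sharp r4 ->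
  (forall v : R, v \in `[0, 1] -> r1 1 v = r2 0 v) ->
  (forall u : R, u \in `[0, 1] -> r1 u 1 = r4 u 0) ->
  (forall v : R, v \in `[0, 1] ->
     partial_u r2 0 v = lambda12 *: partial_u r1 1 v) ->
  (forall u : R, u \in `[0, 1] ->
     partial_v r4 u 0 = lambda14 *: partial_v r1 u 1) ->
  ((exists q3 : 'I_6 -> 'I_6 -> 'rV[R]_3, requirements q3) /\
   (forall q3 q3' : 'I_6 -> 'I_6 -> 'rV[R]_3,
      requirements q3 -> requirements q3' ->
      forall i j : 'I_6, (i <= 1)%N || (j <= 1)%N -> q3 i j = q3' i j))
  <->
  (3 * lambda12 * beta1_23 = 2 * alpha43 - 2 * lambda12 /\
   3 * lambda14 * beta1_43 = 2 * alpha23 - 2 * lambda14).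
Proof.
move=> r1 r2 r4 L23 L43 K23 K43 reqs [_ r1reg] _ _ e12 e14 e2 e4.
pose c1 := coord q1; pose c2 := coord q2; pose c4 := coord q4.
pose A k := isocurve (c2 k) 1; pose B k := isocurve (transpose (c4 k)) 1.
pose C k := glued_tangent lambda14 alpha23 lambda23_1
  beta1_23 beta2_23 kappa23_1 (c2 k).
pose D k := glued_tangent lambda12 alpha43 lambda43_1
  beta1_43 beta2_43 kappa43_1 (transpose (c4 k)).
have g12 : forall k, isocurve (transpose (c1 k)) 1 = isocurve (transpose (c2 k)) 0.
  by apply/poly_row_eq => v /e12; rewrite /r1 /r2 !bezier_transposeE.
have g14 : forall k, isocurve (c1 k) 1 = isocurve (c4 k) 0.
  by apply/poly_row_eq => u /e14; rewrite /r1 /r4 !bezierE.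
have g2 : forall k, crosscurve (transpose (c2 k)) 0 =
    lambda12 *: crosscurve (transpose (c1 k)) 1.
  apply/poly_row_eq => v /e2; rewrite /r1 /r2 !partial_u_transposeE => ->.
  by apply/rowP => k; rewrite !mxE hornerZ.
have g4 : forall k, crosscurve (c4 k) 0 = lambda14 *: crosscurve (c1 k) 1.
  apply/poly_row_eq => u /e4; rewrite /r1 /r4 !partial_vE => ->.
  by apply/rowP => k; rewrite !mxE hornerZ.
have corner k := corner_compatibility alpha23 lambda23_1
  beta1_23 beta2_23 kappa23_1 alpha43 lambda43_1
  beta1_43 beta2_43 kappa43_1 (g12 k) (g2 k) (g14 k) (g4 k).
(* C and D are the prescribed cross-boundary derivatives. *)
have CE u : \row_k (C k).[u] =
    L23 u *: partial_v r2 u 1 + K23 u *: partial_u r2 u 1.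
  rewrite /r2 partial_vE partial_uE; apply/rowP => k.
  by rewrite !mxE hornerD !hornerM horner_bquad horner_bcubic.
have DE v : \row_k (D k).[v] =
    L43 v *: partial_u r4 1 v + K43 v *: partial_v r4 1 v.
  rewrite /r4 partial_u_transposeE partial_v_transposeE; apply/rowP => k.
  by rewrite !mxE hornerD !hornerM horner_bquad horner_bcubic.
have reqsE q3 : reqs q3 <->
    forall k, [/\ isocurve (coord q3 k) 0 = A k,
      isocurve (transpose (coord q3 k)) 0 = B k,
      crosscurve (coord q3 k) 0 = C k &
      crosscurve (transpose (coord q3 k)) 0 = D k].
  split=> [[h1 h2 h3 h4] k|h].
    split; move: k; apply/poly_row_eq => u u01.
    - by rewrite -bezierE h1// /r2 bezierE.
    - by rewrite -bezier_transposeE h2// /r4 bezier_transposeE.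
    - by rewrite -partial_vE h3// CE.
    - by rewrite -partial_u_transposeE h4// DE.
  split=> u _.
  - by rewrite /r2 !bezierE; apply/rowP => k; rewrite !mxE; have [-> _ _ _] := h k.
  - rewrite /r4 !bezier_transposeE; apply/rowP => k.
    by rewrite !mxE; have [_ -> _ _] := h k.
  - by rewrite -CE partial_vE; apply/rowP => k; rewrite !mxE; have [_ _ -> _] := h k.
  - rewrite -DE partial_u_transposeE; apply/rowP => k.
    by rewrite !mxE; have [_ _ _ ->] := h k.
(* Any solution makes the two mixed derivatives at the corner agree. *)
split=> [[[q3 /reqsE h] _]|[c23 c43]].
  have u1 : (1 : R) \in `[0, 1] by rewrite in_itv /= ler01 lexx.
  have := r1reg 1 1 u1 u1.
  rewrite /r1 partial_uE partial_vE => /crossprod_neq0_free indep.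
  suff /indep[/subr0_eq ? /subr0_eq ?] :
      (3 * lambda12 * beta1_23 - (2 * alpha43 - 2 * lambda12)) *:
        (\row_k (isocurve (coord q1 k) 1)^`().[1]) =
      (3 * lambda14 * beta1_43 - (2 * alpha23 - 2 * lambda14)) *:
        (\row_k (crosscurve (coord q1 k) 1).[1]) by split.
  apply/rowP => k; rewrite !mxE; apply/subr0_eq.
  have [_ _ _ <-] := corner k; have [_ _ hC hD] := h k.
  by rewrite -/(C k) -/(D k) -hC -hD twist_swap subrr.
split=> [|q3 q3' /reqsE h /reqsE h' i j ij].
  have /choice[net hnet] k : exists c : 'I_6 -> 'I_6 -> R,
      [/\ isocurve c 0 = A k, crosscurve c 0 = C k,
        isocurve (transpose c) 0 = B k & crosscurve (transpose c) 0 = D k].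
    have [AB CB AD CD] := corner k.
    apply: corner_interpolation => //.
    - exact: leq_trans (size_bcurve _) _.
    - exact: size_glued_tangent.
    - exact: leq_trans (size_bcurve _) _.
    - exact: size_glued_tangent.
    - by apply/subr0_eq; rewrite CD c23 c43 !subrr !mul0r subrr.
  exists (fun i j => \row_k net k i j); apply/reqsE => k.
  have -> : coord (fun i j => \row_k net k i j) k = net k.
    by apply/funext => i; apply/funext => j; rewrite /coord mxE.
  by have [? ? ? ?] := hnet k.
apply/rowP => k; have [hA hB hC hD] := h k; have [hA' hB' hC' hD'] := h' k.
case/orP: ij => [i1|j1].
  apply: (@boundary_strip_inj _ _ _ (transpose (coord q3 k))
    (transpose (coord q3' k))) => //; first by rewrite hB hB'.
  by rewrite hD hD'.
apply: (@boundary_strip_inj _ _ _ (coord q3 k) (coord q3' k)) => //.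
  by rewrite hA hA'.
by rewrite hC hC'.
Qed.
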